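(* Let $k$ be an integer and let $\mathcal{A}_k$ be the set of all $k$-Arndt compositions (of all weights $n\ge0$). Then $$\sum_{\sigma\in\mathcal{A}_k}x^{|\sigma|}y^{\mathrm{parts}(\sigma)}=\begin{cases} \dfrac{(1 - x^2) (1 - x (1 - y))}{1 - x - x^2 + x^3 - x^{3 + k} y^2},& \text{if } k\geq 0,\\[2ex] \dfrac{(1 - x^2) (1 - x (1 - y))}{1 - x - x^2 (1 + y^2) + x^3 (1 - y^2) + y^2 x^{2 - k}},& \text{if } k< 0. \end{cases}$$
   Context: A composition of $n\ge0$ is a finite sequence $\sigma=(\sigma_1,\dots,\sigma_\ell)$ of positive integers summing to $n=|\sigma|$, with $\mathrm{parts}(\sigma)=\ell$ (the empty composition is the composition of $0$ with $0$ parts). For an integer $k$, a $k$-Arndt composition is a composition satisfying $\sigma_{2i-1}>\sigma_{2i}+k$ for every positive integer $i$ with $2i\le \ell$. *)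

(* Defs.v *)
From HB Require Import structures.
From mathcomp Require Import all_boot all_order all_algebra.
From mathcomp Require Import mathcomp_extra boolp classical_sets functions.
From mathcomp Require Import cardinality fsbigop.

Set Implicit Arguments.
Unset Strict Implicit.
Unset Printing Implicit Defensive.

Import Order.TTheory GRing.Theory Num.Theory.
Local Open Scope ring_scope.

(* The ring Z[[x, y]]; [scoef f n m] is the coefficient of x^n y^m.  A record
   is used because bare functions already carry the pointwise product. *)
Record series := Series { scoef : nat -> nat -> int }.

Lemma seriesP (f g : series) : (forall n m, scoef f n m = scoef g n m) -> f = g.
Proof.
case: f g => [f] [g] /= fg; congr Series.
by apply/funext => n; apply/funext => m; exact: fg.
Qed.

HB.instance Definition _ := gen_eqMixin series.
HB.instance Definition _ := gen_choiceMixin series.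

Definition series0 := Series (fun _ _ => 0).
Definition series1 := Series (fun n m => ((n == 0%N) && (m == 0%N))%:R).
Definition series_add f g := Series (fun n m => scoef f n m + scoef g n m).
Definition series_opp f := Series (fun n m => - scoef f n m).
Definition series_mul f g :=
  Series (fun n m => \sum_(i < n.+1) \sum_(j < m.+1)
            scoef f i j * scoef g (n - i) (m - j)).

Fact series_addA : associative series_add.
Proof. by move=> f g h; apply: seriesP => n m /=; rewrite addrA. Qed.

Fact series_addC : commutative series_add.
Proof. by move=> f g; apply: seriesP => n m /=; rewrite addrC. Qed.

Fact series_add0 : left_id series0 series_add.
Proof. by move=> f; apply: seriesP => n m /=; rewrite add0r. Qed.

Fact series_addN : left_inverse series0 series_opp series_add.
Proof. by move=> f; apply: seriesP => n m /=; rewrite addNr. Qed.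

HB.instance Definition _ := GRing.isZmodule.Build series
  series_addA series_addC series_add0 series_addN.

(* The ring axioms are transferred from {poly {poly int}} by truncation. *)
Definition series_trunc (N M : nat) (f : series) : {poly {poly int}} :=
  \poly_(i < N.+1) \poly_(j < M.+1) scoef f i j.

Lemma coef_series_trunc N M f n m : (n <= N)%N -> (m <= M)%N ->
  (series_trunc N M f)`_n`_m = scoef f n m.
Proof. by move=> nN mM; rewrite coef_poly ltnS nN coef_poly ltnS mM. Qed.

Lemma coef2M (p q : {poly {poly int}}) n m :
  (p * q)`_n`_m =
  \sum_(i < n.+1) \sum_(j < m.+1) p`_i`_j * q`_(n - i)`_(m - j).
Proof. by rewrite coefM coef_sum; apply: eq_bigr => i _; rewrite coefM. Qed.

Lemma series_mulE N M f g n m (p q : {poly {poly int}}) : (n <= N)%N -> (m <= M)%N ->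
  (forall i j, (i <= N)%N -> (j <= M)%N -> p`_i`_j = scoef f i j) ->
  (forall i j, (i <= N)%N -> (j <= M)%N -> q`_i`_j = scoef g i j) ->
  (p * q)`_n`_m = scoef (series_mul f g) n m.
Proof.
move=> nN mM pf qg; rewrite coef2M /=.
apply: eq_bigr => i _; apply: eq_bigr => j _.
rewrite pf ?qg //; try by rewrite (leq_trans (leq_subr _ _)).
  by rewrite (leq_trans _ nN) // -ltnS.
by rewrite (leq_trans _ mM) // -ltnS.
Qed.

Fact series_mulA : associative series_mul.
Proof.
move=> f g h; apply: seriesP => n m.
pose t := series_trunc n m.
have tE k i j : (i <= n)%N -> (j <= m)%N -> (t k)`_i`_j = scoef k i j.
  exact: coef_series_trunc.
have tM k l i j : (i <= n)%N -> (j <= m)%N ->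
    (t k * t l)`_i`_j = scoef (series_mul k l) i j.
  by move=> ilen jlem; exact: (series_mulE ilen jlem (tE k) (tE l)).
rewrite -(series_mulE (leqnn n) (leqnn m) (tE f) (tM g h)).
by rewrite -(series_mulE (leqnn n) (leqnn m) (tM f g) (tE h)) mulrA.
Qed.

Fact series_mulC : commutative series_mul.
Proof.
move=> f g; apply: seriesP => n m; pose t := series_trunc n m.
have tE k i j : (i <= n)%N -> (j <= m)%N -> (t k)`_i`_j = scoef k i j.
  exact: coef_series_trunc.
rewrite -(series_mulE (leqnn n) (leqnn m) (tE f) (tE g)) mulrC.
exact: (series_mulE (leqnn n) (leqnn m) (tE g) (tE f)).
Qed.

Fact series_mul1 : left_id series1 series_mul.
Proof.
move=> f; apply: seriesP => n m; pose t := series_trunc n m.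
have tE k i j : (i <= n)%N -> (j <= m)%N -> (t k)`_i`_j = scoef k i j.
  exact: coef_series_trunc.
have t1 i j : (i <= n)%N -> (j <= m)%N ->
    (1 : {poly {poly int}})`_i`_j = scoef series1 i j.
  by move=> _ _ /=; rewrite coef1; case: i => [|i]; rewrite ?coef1 ?coef0.
by rewrite -(series_mulE (leqnn n) (leqnn m) t1 (tE f)) mul1r tE.
Qed.

Fact series_mulDl : left_distributive series_mul +%R.
Proof.
move=> f g h; apply: seriesP => n m /=.
rewrite -big_split /=; apply: eq_bigr => i _.
by rewrite -big_split /=; apply: eq_bigr => j _; rewrite mulrDl.
Qed.

Fact series1_neq0 : series1 != 0.
Proof. by apply/eqP => /(congr1 (fun f => scoef f 0 0)). Qed.

HB.instance Definition _ := GRing.Zmodule_isComNzRing.Build series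
  series_mulA series_mulC series_mul1 series_mulDl series1_neq0.

Definition series_unit : pred series := fun f => `[< exists g, g * f = 1 >].
Definition series_inv (f : series) : series :=
  if pselect (exists g, g * f = 1) is left e then projT1 (cid e) else f.

Fact series_mulV : {in series_unit, left_inverse 1 series_inv *%R}.
Proof.
move=> f /asboolP fU; rewrite /series_inv; case: pselect => // e.
exact: projT2 (cid e).
Qed.

Fact series_unitPl (f g : series) : g * f = 1 -> series_unit f.
Proof. by move=> gf; apply/asboolP; exists g. Qed.

Fact series_inv_out : {in [predC series_unit], series_inv =1 id}.
Proof.
by move=> f /asboolPn fU; rewrite /series_inv; case: pselect.
Qed.

HB.instance Definition _ := GRing.ComNzRing_hasMulInverse.Build series
  series_mulV series_unitPl series_inv_out.

Definition sX : series := Series (fun n m => ((n == 1%N) && (m == 0%N))%:R).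
Definition sY : series := Series (fun n m => ((n == 0%N) && (m == 1%N))%:R).

Lemma scoefD f g n m : scoef (f + g) n m = scoef f n m + scoef g n m.
Proof. by []. Qed.

Lemma scoefN f n m : scoef (- f) n m = - scoef f n m.
Proof. by []. Qed.

Lemma scoefM f g n m : scoef (f * g) n m =
  \sum_(i < n.+1) \sum_(j < m.+1) scoef f i j * scoef g (n - i) (m - j).
Proof. by []. Qed.

Lemma scoef1 n m : scoef 1 n m = ((n == 0%N) && (m == 0%N))%:R.
Proof. by []. Qed.

Lemma scoefXM f n m : scoef (sX * f) n m = if n is n'.+1 then scoef f n' m else 0.
Proof.
rewrite scoefM /=; case: n => [|n].
  by rewrite big1 // => i _; rewrite big1 // => j _; rewrite ord1 mul0r.
rewrite (bigD1 (inord 1)) //= inordK // big_ord_recl /= mul1r subn0 subSS subn0.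
rewrite big1 ?addr0 => [|j _]; last by rewrite mul0r.
rewrite big1 ?addr0 // => i i1; rewrite big1 // => j _.
case: eqP => [e|_]; last by rewrite mul0r.
by case/eqP: i1; apply: val_inj; rewrite /= inordK.
Qed.

Lemma scoefYM f n m : scoef (sY * f) n m = if m is m'.+1 then scoef f n m' else 0.
Proof.
rewrite scoefM /= big_ord_recl /= [X in _ + X]big1 ?addr0; last first.
  by move=> i _; rewrite big1 // => j _; rewrite mul0r.
case: m => [|m].
  by rewrite big1 // => j _; rewrite ord1 mul0r.
rewrite (bigD1 (inord 1)) //= inordK // mul1r subn0 subSS subn0.
rewrite big1 ?addr0 // => i i1.
case: eqP => [e|_]; last by rewrite mul0r.
by case/eqP: i1; apply: val_inj; rewrite /= inordK.
Qed.

Lemma scoef_monomial a b n m :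
  scoef (sX ^+ a * sY ^+ b) n m = ((n == a) && (m == b))%:R.
Proof.
elim: a n m => [|a IH] n m; last first.
  by rewrite exprS -mulrA scoefXM; case: n => // n; rewrite IH.
rewrite expr0 mul1r; elim: b n m => [|b IH] n m; first by [].
by rewrite exprS scoefYM; case: m => [|m]; rewrite ?andbF // IH.
Qed.

(* Infinite sum of a family of series, computed coefficientwise.  It is
   meaningful when each coefficient is nonzero for finitely many members of the
   family (outside that case [\sum_(_ \in _)] is 0 by convention). *)
Definition series_sum (T : choiceType) (A : set T) (F : T -> series) : series :=
  Series (fun n m => \sum_(t \in A) scoef (F t) n m).

Definition composition (s : seq nat) : Prop := {in s, forall p, (0 < p)%N}.

(* [part s j] is the j-th part of [s], counted from 1. *)
Definition part (s : seq nat) (j : nat) : nat := nth 0%N s j.-1.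

Definition Arndt (k : int) : set (seq nat) :=
  [set s | composition s /\
    forall i : nat, (0 < i)%N -> (2 * i <= size s)%N ->
      (part s (2 * i - 1))%:Z > (part s (2 * i))%:Z + k].

(* Only finitely many compositions contribute to a given coefficient of the
   generating function, so [series_sum] is not used with its default value. *)
Lemma finite_Arndt_coef (k : int) (n m : nat) :
  finite_set [set s | Arndt k s /\
    scoef (sX ^+ sumn s * sY ^+ size s) n m != 0].
Proof.
pose f (t : m.-tuple 'I_n.+1) := [seq val i | i <- t].
apply: (@sub_finite_set _ _ [set f t | t in setT]); last first.
  by apply: finite_image; exact: finite_finset.
move=> s [_]; rewrite scoef_monomial.
case: andP => // -[/eqP ns /eqP ms] _.
have sP : size [seq inord i : 'I_n.+1 | i <- s] == m by rewrite size_map ms.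
exists (Tuple sP) => //; rewrite /f /= -map_comp -[RHS]map_id.
apply/eq_in_map => p ps; rewrite /= inordK // ltnS ns.
by rewrite sumnE (big_rem p ps) leq_addr.
Qed.

(* A series with constant term 1 is invertible, so the quotients in the
   generating function are genuine. *)
Lemma series_unit_coef0 (f : series) : scoef f 0 0 = 1 -> f \is a GRing.unit.
Proof.
move=> f1; pose u := 1 - f.
have u0 : scoef u 0 0 = 0 by rewrite /u scoefD scoefN f1.
have uX N : forall n m, (n + m < N)%N -> scoef (u ^+ N) n m = 0.
  elim: N => // N IH n m nmN; rewrite exprS scoefM big1 // => i _.
  rewrite big1 // => j _.
  have [/eqP ij0|ij0] := boolP (i + j == 0)%N.
    by move: ij0 => /eqP; rewrite addn_eq0 => /andP[/eqP-> /eqP->]; rewrite u0 mul0r.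
  have le_i : (i <= n)%N by rewrite -ltnS.
  have le_j : (j <= m)%N by rewrite -ltnS.
  rewrite IH ?mulr0 // -ltnS (leq_trans _ nmN) // !ltnS.
  move: {IH nmN} (i : nat) (j : nat) ij0 le_i le_j => a b ab0 le_a le_b.
  rewrite -{2}(subnKC le_a) -{2}(subnKC le_b) addnACA.
  by rewrite -[X in (X < _)%N]add0n ltn_add2r lt0n.
pose g := Series (fun n m => scoef (\sum_(l < (n + m).+1) u ^+ l) n m).
have gE N n m : (n + m < N)%N -> scoef g n m = scoef (\sum_(l < N) u ^+ l) n m.
  elim: N => // N IH; rewrite ltnS leq_eqVlt => /orP[/eqP <- //|nmN].
  by rewrite big_ord_recr scoefD uX // addr0 IH.
apply/unitrP; suff fg : g * f = 1 by exists g; split=> //; rewrite mulrC.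
apply: seriesP => n m.
transitivity (scoef ((\sum_(l < (n + m).+1) u ^+ l) * f) n m).
  rewrite !scoefM; apply: eq_bigr => i _; apply: eq_bigr => j _.
  by rewrite (gE (n + m).+1) // ltnS leq_add // -ltnS.
have -> : f = 1 - u by rewrite /u opprB addrC subrK.
rewrite mulrC -(opprB u) mulNr -subrX1 opprB scoefD scoefN uX //.
by rewrite oppr0 addr0.
Qed.

Lemma Arndt_den_ge0_unit (k : int) : 0 <= k ->
  1 - sX - sX ^+ 2 + sX ^+ 3 - sX ^ (3 + k) * sY ^+ 2 \is a GRing.unit.
Proof.
case: k => // k _; apply: series_unit_coef0.
rewrite -PoszD -exprnP !(scoefD, scoefN, scoef1).
by rewrite addSn !exprS -!mulrA !scoefXM.
Qed.

Lemma Arndt_den_lt0_unit (k : int) : k < 0 ->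
  1 - sX - sX ^+ 2 * (1 + sY ^+ 2) + sX ^+ 3 * (1 - sY ^+ 2)
    + sY ^+ 2 * sX ^ (2 - k) \is a GRing.unit.
Proof.
case: k => // k _; apply: series_unit_coef0.
have -> : 2 - Negz k = (k.+1 + 2)%N :> int by rewrite NegzE opprK addrC.
rewrite -exprnP !(scoefD, scoefN, scoef1) [sY ^+ 2 * _]mulrC addSn.
by rewrite !exprS -!mulrA !scoefXM.
Qed.

(* Main.v *)
(* A k-Arndt composition is empty, a single part, or an admissible pair
   (a, b) with a > b + k followed by a k-Arndt composition.  Hence the generating
   function G satisfies G = 1 + x y / (1 - x) + P G, where P is the generating
   function of the admissible pairs.  For k >= 0, writing a = b + k + 1 + c gives
   P = x^(k+3) y^2 / ((1 - x) (1 - x^2)); for k < 0, P is obtained by removing from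
   all pairs those with b = a - k + c. *)
Require Import Defs.
From mathcomp Require Import all_boot all_order all_algebra.
From mathcomp Require Import finmap boolp classical_sets functions cardinality fsbigop.
From mathcomp Require Import zify ring.

Set Implicit Arguments.
Unset Strict Implicit.
Unset Printing Implicit Defensive.

Import GRing.Theory Num.Theory.
Local Open Scope classical_set_scope.
Local Open Scope ring_scope.

(** * Summable families of series *)

(** Under this condition no coefficient of [series_sum A F] falls back to the default value 0 of an
    infinite sum. *)
Definition summable (T : choiceType) (A : set T) (F : T -> series) : Prop :=
  forall n m, finite_set (A `&` [set t | scoef (F t) n m != 0]).

Lemma summableS (T : choiceType) (A B : set T) (F : T -> series) :
  A `<=` B -> summable B F -> summable A F.
Proof.
by move=> AB BF n m; apply: sub_finite_set (BF n m) => t [/AB Bt Ft]; split.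
Qed.

Lemma summable_set1 (T : choiceType) (t : T) (F : T -> series) :
  summable [set t] F.
Proof.
move=> n m; apply: sub_finite_set (finite_set1 t).
by move=> u [].
Qed.

(* All coefficients in a given box are computed by one finite subfamily. *)
Lemma summable_box (T : choiceType) (A : set T) (F : T -> series) (n m : nat) :
  summable A F ->
  exists2 D : set T, finite_set D /\ D `<=` A &
    forall i j t, (i <= n)%N -> (j <= m)%N -> A t -> ~ D t -> scoef (F t) i j = 0.
Proof.
move=> AF.
pose S i j := A `&` [set t | scoef (F t) i j != 0].
exists (\bigcup_(i in `I_n.+1) \bigcup_(j in `I_m.+1) S i j).
  split; last by move=> t [i _ [j _ []]].
  by apply: bigcup_finite => // i _; apply: bigcup_finite => // j _; apply: AF.
move=> i j t le_in le_jm At ND; apply: contrapT => /eqP Ft.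
by apply: ND; exists i => //; exists j.
Qed.

Lemma scoef_sum (I : Type) (r : seq I) (F : I -> series) n m :
  scoef (\sum_(i <- r) F i) n m = \sum_(i <- r) scoef (F i) n m.
Proof. by apply: (big_morph (fun f => scoef f n m)). Qed.

Lemma eq_series_sum (T : choiceType) (A : set T) (F G : T -> series) :
  (forall t, A t -> F t = G t) -> series_sum A F = series_sum A G.
Proof.
move=> FG; apply: seriesP => n m /=; apply: eq_fsbigr => t.
by rewrite inE => At; rewrite FG.
Qed.

Lemma series_sum_set1 (T : choiceType) (t : T) (F : T -> series) :
  series_sum [set t] F = F t.
Proof. by apply: seriesP => n m /=; rewrite fsbig_set1. Qed.

Lemma series_sum_image (T U : choiceType) (h : T -> U) (A : set T)
    (F : U -> series) :
  injective h -> series_sum (h @` A) F = series_sum A (fun t => F (h t)).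
Proof.
move=> h_inj; apply: seriesP => n m /=.
by rewrite fsbig_image // => t u _ _; exact: h_inj.
Qed.

Lemma series_sumU (T : choiceType) (A B : set T) (F : T -> series) :
  summable A F -> summable B F -> A `&` B `<=` set0 ->
  series_sum (A `|` B) F = series_sum A F + series_sum B F.
Proof.
move=> AF BF AB0; apply: seriesP => n m; rewrite scoefD /=.
have fS C : summable C F ->
    finite_set (C `&` (fun t => scoef (F t) n m) @^-1` [set~ 0]).
  by move=> CF; apply: sub_finite_set (CF n m) => t [Ct /eqP Ft]; split.
(* Restricting to the support makes both index sets finite, as additivity over a disjoint union
   requires. *)
rewrite fsbig_supp setIUl fsbigU0; [|exact: fS|exact: fS|].
  by rewrite -!fsbig_supp.
by move=> t [[At _] [Bt _]]; apply: AB0.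
Qed.

(** * Products of summable families *)

Lemma scoefM_eq0 (f g : series) n m :
  (forall i j, (i <= n)%N -> (j <= m)%N -> scoef f i j = 0) ->
  scoef (f * g) n m = 0.
Proof.
move=> f0; rewrite scoefM big1 // => i _; rewrite big1 // => j _.
by rewrite f0 ?mul0r // -ltnS.
Qed.

(** A pair outside [D]*[E] has a component outside [D] or [E]; that factor vanishes on the whole
    box, and the coefficient at (n, m) of a product only involves coefficients in the box. *)
Lemma scoefM_box_eq0 (T U : choiceType) (A D : set T) (B E : set U)
    (F : T -> series) (G : U -> series) (n m : nat) :
  (forall i j t, (i <= n)%N -> (j <= m)%N -> A t -> ~ D t ->
     scoef (F t) i j = 0) ->
  (forall i j u, (i <= n)%N -> (j <= m)%N -> B u -> ~ E u ->
     scoef (G u) i j = 0) ->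
  forall p, (A `*` B) p -> ~ (D `*` E) p -> scoef (F p.1 * G p.2) n m = 0.
Proof.
move=> F0 G0 [t u] [At Bu] /not_andP[] N; last rewrite mulrC.
  by apply: scoefM_eq0 => i j ? ?; apply: F0.
by apply: scoefM_eq0 => i j ? ?; apply: G0.
Qed.

Lemma summableM (T U : choiceType) (A : set T) (B : set U)
    (F : T -> series) (G : U -> series) :
  summable A F -> summable B G ->
  summable (A `*` B) (fun p => F p.1 * G p.2).
Proof.
move=> AF BG n m.
have [D [Dfin DA] F0] := summable_box n m AF.
have [E [Efin EB] G0] := summable_box n m BG.
apply: sub_finite_set (finite_setX Dfin Efin) => p [ABp /eqP FGp].
by apply: contrapT => Np; apply: FGp; exact: scoefM_box_eq0 F0 G0 _ ABp Np.
Qed.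

(** For a fixed coefficient, both families can be cut down to the finite sets [D] and [E], where the
    identity is distributivity of finite sums. *)
Lemma series_sumM (T U : choiceType) (A : set T) (B : set U)
    (F : T -> series) (G : U -> series) :
  summable A F -> summable B G ->
  series_sum (A `*` B) (fun p => F p.1 * G p.2) =
  series_sum A F * series_sum B G.
Proof.
move=> AF BG; apply: seriesP => n m.
have [D [Dfin DA] F0] := summable_box n m AF.
have [E [Efin EB] G0] := summable_box n m BG.
have box (V : choiceType) (C K : set V) (H : V -> series) i j :
    finite_set K -> K `<=` C ->
    (forall t, C t -> ~ K t -> scoef (H t) i j = 0) ->
    scoef (series_sum C H) i j = scoef (\sum_(t <- fset_set K) H t) i j.
  move=> Kfin KC H0; rewrite scoef_sum -fsbig_finite //=.
  by apply/esym/fsbig_widen => // t [Ct NKt]; exact: H0.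
transitivity (scoef
    ((\sum_(t <- fset_set D) F t) * (\sum_(u <- fset_set E) G u)) n m); last first.
  rewrite !scoefM; apply: eq_bigr => i _; apply: eq_bigr => j _.
  congr (_ * _); apply/esym/box => // t Ct Nt.
    by apply: F0; rewrite // -ltnS.
  by apply: G0; rewrite // leq_subr.
have DEfin := finite_setX Dfin Efin.
rewrite (box _ _ (D `*` E)) //; last first.
- exact: scoefM_box_eq0 F0 G0.
- by move=> p [/DA ? /EB ?].
congr (scoef _ n m); rewrite -fsbig_finite // -(pair_fsbig _ (fun t u => F t * G u)) //.
rewrite fsbig_finite // mulr_suml; apply: eq_bigr => t _.
by rewrite fsbig_finite // mulr_sumr.
Qed.

Lemma series_sumZl (T : choiceType) (A : set T) (c : series) (F : T -> series) :
  summable A F -> series_sum A (fun t => c * F t) = c * series_sum A F.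
Proof.
(* The constant [c] is viewed as a family indexed by [unit], which reduces the claim to
   [series_sumM]. *)
move=> AF; have inj : injective (fun t : T => (tt, t)) by move=> t u [].
rewrite -[in RHS](series_sum_set1 tt (fun=> c)) -series_sumM //; last first.
  exact: summable_set1.
rewrite (_ : [set tt] `*` A = (fun t => (tt, t)) @` A) ?series_sum_image //.
by apply/seteqP; split=> [[[] t] [_ At]|_ [t At <-]] //; exists t.
Qed.

(** * Geometric series *)

Lemma summable_geom d : (0 < d)%N -> summable [set: nat] (fun a => sX ^+ (d * a)).
Proof.
move=> d0 n m; apply: sub_finite_set (finite_II n.+1) => a [_] /=.
(* The factor y^0 gives the term the shape of a monomial; d * a = n with d > 0 then bounds a by
   n. *)
rewrite -[_ ^+ _]mulr1 -[1 in X in X -> _](expr0 sY) scoef_monomial.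
by case: (n =P _) => [-> _|_ /eqP//]; rewrite ltnS leq_pmull.
Qed.

(** For d > 0 this is 1 / (1 - x^d). *)
Definition geom d := series_sum [set: nat] (fun a => sX ^+ (d * a)).

Lemma geomE d : (0 < d)%N -> (1 - sX ^+ d) * geom d = 1.
Proof.
move=> d0; have gS := summable_geom d0.
suff gE : geom d = 1 + sX ^+ d * geom d by rewrite mulrBl mul1r {1}gE addrK.
(* The term a = 0 is split off; shifting the remaining indices by one extracts a factor x^d. *)
rewrite {1}/geom (_ : [set: nat] = [set 0%N] `|` succn @` [set: nat]); last first.
  by apply/seteqP; split=> // -[|a] _; [left|right; exists a].
rewrite series_sumU.
- rewrite series_sum_set1 muln0 expr0; congr (_ + _).
  rewrite series_sum_image; last exact: succn_inj.
  rewrite -series_sumZl //; apply: eq_series_sum => a _.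
  by rewrite mulnS exprD.
- exact: summable_set1.
- exact: summableS gS.
- by move=> a [-> [b _]].
Qed.

(** Sets of pairs are parametrized below by two free naturals in which the weight exponent is
    affine; this evaluates the resulting sums. *)
Lemma geom2E c d e : (0 < d)%N -> (0 < e)%N ->
  series_sum [set: nat * nat] (fun p => sX ^+ (c + d * p.1 + e * p.2) * sY ^+ 2) =
  sX ^+ c * sY ^+ 2 * (geom d * geom e).
Proof.
move=> d0 e0; have [gd ge] := (summable_geom d0, summable_geom e0).
rewrite -(series_sumM gd ge) -(series_sumZl _ (summableM gd ge)).
rewrite setXTT; apply: eq_series_sum => p _.
by rewrite !exprD; ring.
Qed.

(** * Generating function of the admissible pairs *)

Definition arndt_pair (k : int) : set (nat * nat) :=
  [set p | [/\ (0 < p.1)%N, (0 < p.2)%N & p.1%:Z > p.2%:Z + k]].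

Definition pair_weight (p : nat * nat) : series := sX ^+ (p.1 + p.2) * sY ^+ 2.

Definition pair_series k := series_sum (arndt_pair k) pair_weight.

Lemma summable_pair_weight : summable [set: nat * nat] pair_weight.
Proof.
move=> n m.
apply: sub_finite_set (finite_setX (finite_II n.+1) (finite_II n.+1)).
move=> [a b] [_]; rewrite /mkset /pair_weight scoef_monomial.
by case: (n =P _) => [-> _|_ /eqP//]; split=> /=; lia.
Qed.

Lemma pair_series_ge0 (k : nat) :
  pair_series k = sX ^+ (3 + k) * sY ^+ 2 * (geom 2 * geom 1).
Proof.
rewrite -geom2E // /pair_series.
(* Here b = p.1 + 1 and a = b + k + 1 + p.2, so a + b = 3 + k + 2 p.1 + p.2. *)
pose h (p : nat * nat) := ((p.1 + k + p.2).+2, p.1.+1)%N.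
rewrite (_ : arndt_pair k = h @` setT).
  rewrite series_sum_image; last by move=> [a b] [c d] [/= ? ?]; congr pair; lia.
  by apply: eq_series_sum => p _; congr (_ ^+ _ * _); rewrite /=; lia.
apply/seteqP; split=> [[a b] [/= a0 b0 ab]|_ [[a b] _ <-]]; last by split=> /=; lia.
by exists (b.-1, a - b - k - 1)%N => //; congr pair => /=; lia.
Qed.

(* The pairs (a, b) excluded when k = - j are those with b = a + j + c, c >= 0. *)
Lemma pair_series_lt0 (j : nat) :
  pair_series (- j%:Z) = sX ^+ 2 * sY ^+ 2 * (geom 1 * geom 1)
                         - sX ^+ (2 + j) * sY ^+ 2 * (geom 2 * geom 1).
Proof.
(* Moving the subtracted series across turns the claim into a disjoint union: all positive pairs,
   parametrized by [g], are the admissible ones and the excluded ones, parametrized by [h]. *)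
apply/eqP; rewrite eq_sym subr_eq -!geom2E //; apply/eqP.
pose g (p : nat * nat) := (p.1.+1, p.2.+1).
pose h (p : nat * nat) := (p.1.+1, (p.1 + j + p.2).+1)%N.
transitivity (series_sum (g @` setT) pair_weight).
  rewrite series_sum_image; last by move=> [a b] [c d] [/= -> ->].
  by apply: eq_series_sum => p _; congr (_ ^+ _ * _); rewrite /=; lia.
have -> : g @` setT = arndt_pair (- j%:Z) `|` h @` setT.
  apply/seteqP; split=> [_ [[a b] _ <-]|[a b] [[/= a0 b0 ab]|[[c d] _ [<- <-]]]].
  - have [ab|ab] := leqP (a + j) b; last by left; split=> /=; lia.
    by right; exists (a, b - a - j)%N => //; congr pair => /=; lia.
  - by exists (a.-1, b.-1) => //; congr pair => /=; lia.
  - by exists (c, c + j + d)%N.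
rewrite series_sumU; [|exact: summableS summable_pair_weight..|].
  congr (_ + _); rewrite series_sum_image.
    by apply: eq_series_sum => p _; congr (_ ^+ _ * _); rewrite /=; lia.
  by move=> [a b] [c d] [/= ? ?]; congr pair; lia.
by move=> p [] /[swap] -[[a b] _ <-] [_ _] /=; lia.
Qed.

(** * Decomposition of Arndt compositions *)

(** Dropping two parts preserves the pairing of odd with even positions: condition i on [s] is
    condition i + 1 on the whole list. *)
Lemma Arndt_cons2 k a b s :
  Arndt k [:: a, b & s] <-> arndt_pair k (a, b) /\ Arndt k s.
Proof.
split=> [[pos ineq]|[[/= a0 b0 ab] [pos ineq]]]; split.
- split=> /=; [apply: pos|apply: pos|exact: (ineq 1%N)];
    by rewrite !inE eqxx ?orbT.
- split=> [p ps|[//|i] _ si]; first by apply: pos; rewrite !inE ps !orbT.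
  have := ineq i.+2 isT; rewrite /part.
  (* The two exposed successors let [nth] skip [a] and [b] by computation. *)
  have -> : (2 * i.+2 - 1).-1 = (2 * i.+1 - 1).-1.+2 by lia.
  have -> : (2 * i.+2).-1 = (2 * i.+1).-1.+2 by lia.
  by apply=> /=; lia.
- by move=> p; rewrite !inE => /or3P[/eqP->|/eqP->|/pos].
- move=> [//|[//|i]] _ /= si; have := ineq i.+1 isT; rewrite /part.
  have -> : (2 * i.+2 - 1).-1 = (2 * i.+1 - 1).-1.+2 by lia.
  have -> : (2 * i.+2).-1 = (2 * i.+1).-1.+2 by lia.
  by apply; lia.
Qed.

Lemma ArndtE k : Arndt k =
  [set [::]] `|` ((fun a => [:: a.+1]) @` [set: nat] `|`
  (fun q : (nat * nat) * seq nat => [:: q.1.1, q.1.2 & q.2]) @`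
    (arndt_pair k `*` Arndt k)).
Proof.
apply/seteqP; split=> [[|[|a] [|b s]] As|s].
- by left.
- by case: As => /(_ 0%N); rewrite inE eqxx => /(_ isT).
(* A first part 0 is contradictory, yet [As] yields membership here just as for a positive first
   part. *)
- by right; right; exists ((0%N, b), s) => //; exact/Arndt_cons2.
- by right; left; exists a.
- by right; right; exists ((a.+1, b), s) => //; exact/Arndt_cons2.
- move=> [->|[[a _ <-]|[[[a b] t] [/= ab At] <-]]]; last exact/Arndt_cons2.
    by split=> // -[].
  by split=> [p|[|[]]] //; rewrite inE => /eqP->.
Qed.

Definition word_weight (s : seq nat) : series := sX ^+ sumn s * sY ^+ size s.

Lemma summable_Arndt k : summable (Arndt k) word_weight.
Proof. exact: finite_Arndt_coef. Qed.

Lemma Arndt_series_rec k (G := series_sum (Arndt k) word_weight) :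
  G = 1 + (sX * sY * geom 1 + pair_series k * G).
Proof.
have AS := @summable_Arndt k; have sub := AS.
rewrite {1}/G ArndtE; rewrite ArndtE in sub.
rewrite series_sumU; first last.
- by move=> _ [-> [[]|[]]].
- by apply: summableS sub; exact: subsetUr.
- exact: summable_set1.
rewrite series_sumU; first last.
- by move=> _ [[a _ <-] [[[b c] s] _]].
- by apply: summableS sub => s ?; right; right.
- by apply: summableS sub => s ?; right; left.
rewrite series_sum_set1 /word_weight mul1r expr0; congr (_ + (_ + _)).
  rewrite series_sum_image; last by move=> a b [].
  rewrite -series_sumZl; last exact: summable_geom.
  by apply: eq_series_sum => a _; rewrite /= addn0 mul1n exprS; ring.
rewrite series_sum_image; last by move=> [[a b] s] [[c d] t] [-> -> ->].
(* The weight of [[:: a, b & s]] is the weight of the pair times that of [s], so this sum factors as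
   P G. *)
rewrite -series_sumM //; last exact: summableS summable_pair_weight.
apply: eq_series_sum => -[[a b] s] _ /=.
by rewrite /pair_weight /word_weight addnA !exprD !exprS; ring.
Qed.

(** * Solving the functional equation *)

Theorem theorem4p1 (k : int) :
  series_sum (Arndt k) (fun s => sX ^+ sumn s * sY ^+ size s) =
  if 0 <= k then
    ((1 - sX ^+ 2) * (1 - sX * (1 - sY))) /
    (1 - sX - sX ^+ 2 + sX ^+ 3 - sX ^ (3 + k) * sY ^+ 2)
  else
    ((1 - sX ^+ 2) * (1 - sX * (1 - sY))) /
    (1 - sX - sX ^+ 2 * (1 + sY ^+ 2) + sX ^+ 3 * (1 - sY ^+ 2)
       + sY ^+ 2 * sX ^ (2 - k)).
Proof.
have := Arndt_series_rec k; set G := series_sum _ _ => GE.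
rewrite -[LHS]/G.
have g1 : (1 - sX) * geom 1 = 1 by rewrite -[sX]expr1; exact: geomE.
have g2 : (1 - sX ^+ 2) * geom 2 = 1 by exact: geomE.
have GP : 1 + sX * sY * geom 1 = G - pair_series k * G by rewrite {1}GE; ring.
(* This clears denominators in G (1 - P) = 1 + x y / (1 - x); it remains to match (1 - x)(1 - x^2)(1
   - P) with the denominator in each case. *)
have numE : (1 - sX ^+ 2) * (1 - sX * (1 - sY)) =
    G * ((1 - sX) * (1 - sX ^+ 2) * (1 - pair_series k)).
  transitivity ((1 - sX ^+ 2) * ((1 - sX) + sX * sY * ((1 - sX) * geom 1))).
    by rewrite g1; ring.
  transitivity ((1 - sX) * (1 - sX ^+ 2) * (1 + sX * sY * geom 1)); first by ring.
  by rewrite GP; ring.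
rewrite numE; case: ifPn => k0.
  apply: (canRL (mulrK (Arndt_den_ge0_unit k0))); congr (_ * _).
  case: k k0 {G GE GP numE} => // k _; rewrite pair_series_ge0 -PoszD -exprnP.
  (* Each [geom] is grouped with its inverse so that [g1] and [g2] apply. *)
  transitivity ((1 - sX) * (1 - sX ^+ 2) - sX ^+ (3 + k) * sY ^+ 2 *
      ((1 - sX) * geom 1) * ((1 - sX ^+ 2) * geom 2)); last by ring.
  by rewrite g1 g2; ring.
have {}k0 : k < 0 by rewrite Order.TotalTheory.ltNge.
apply: (canRL (mulrK (Arndt_den_lt0_unit k0))); congr (_ * _).
(* Since [Negz j] is -(j + 1), [pair_series_lt0] is used at j + 1. *)
case: k k0 {G GE GP numE} => // j _; rewrite NegzE opprK pair_series_lt0.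
rewrite -PoszD -exprnP.
(* Writing 1 - x^2 = (1 + x)(1 - x) supplies the second factor 1 - x that cancels the square of
   [geom 1]. *)
transitivity ((1 - sX) * (1 - sX ^+ 2)
    - sX ^+ 2 * sY ^+ 2 * (1 + sX) * ((1 - sX) * geom 1) ^+ 2
    + sX ^+ (2 + j.+1) * sY ^+ 2 * ((1 - sX) * geom 1) * ((1 - sX ^+ 2) * geom 2)).
  by rewrite g1 g2; ring.
by ring.
Qed.
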